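(* Let $\mathcal X=([v],\{R_i\}_{i=0}^d)$ be a symmetric association scheme and let $A$ be an element of its Bose-Mesner algebra. Suppose that $|D_A(k)|=2$ for some positive integer $k$. Then, for every $a\in D_A(k)$, the hypergraph $\mathfrak H_A(v,k,a)$ is a partially balanced incomplete block design (PBIBD) on $\mathcal X$.
   Context: $[v]=\{1,\dots,v\}$. For a $v\times v$ matrix $A$ and $\alpha\subset[v]$, $A[\alpha]$ is the principal submatrix indexed by $\alpha$. $D_A(k)$ is the set of values $\det(A[\alpha])$ over all $k$-subsets $\alpha$ of $[v]$. $\mathfrak H_A(v,k,a)$ is the $k$-uniform hypergraph on $[v]$ whose hyperedges are the $k$-subsets $\alpha$ with $\det(A[\alpha])=a$. A symmetric association scheme with $d\ge1$ classes on a finite set $\mathfrak X$ is $(\mathfrak X,\{R_i\}_{i=0}^d)$, with $R_i$ nonempty subsets of $\mathfrak X\times\mathfrak X$ whose $\{0,1\}$ adjacency matrices $A_i$ (with $(A_i)_{xy}=1$ iff $(x,y)\in R_i$) satisfy: $A_0=I$; $\sum_{i=0}^dA_i=J$ (all-ones); $A_i^{\top}=A_i$ for all $i$; and every product $A_iA_j$ lies in the linear span of $A_0,\dots,A_d$. Its Bose-Mesner algebra is the algebra generated by $A_0,\dots,A_d$ over $\mathbb R$. A PBIBD on this scheme is a uniform hypergraph $(\mathfrak X,\mathfrak B)$ that is a $1$-design (every vertex lies in the same positive number of hyperedges) and such that for each $i\in\{1,\dots,d\}$ there is an integer $\lambda_i\geq0$ such that for every $(x,y)\in R_i$ the pair $\{x,y\}$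 is contained in exactly $\lambda_i$ hyperedges. *)

(* Defs.v *)
From mathcomp Require Import all_boot all_order all_algebra finmap.
From mathcomp Require Import reals.

Set Implicit Arguments.
Unset Strict Implicit.
Unset Printing Implicit Defensive.

Import GRing.Theory.
Local Open Scope ring_scope.

(* The set [v] = {1, ..., v} is represented by the ordinals 'I_v. *)

Definition principal_submx (F : realType) (v : nat) (A : 'M[F]_v)
    (alpha : {set 'I_v}) : 'M[F]_#|alpha| :=
  mxsub (@enum_val _ (mem alpha)) (@enum_val _ (mem alpha)) A.

Definition minor_values (F : realType) (v : nat) (A : 'M[F]_v) (k : nat) :
    {fset F} :=
  [fset \det (principal_submx A alpha)
     | alpha in [set alpha : {set 'I_v} | #|alpha| == k]]%fset.

(* A hypergraph on 'I_v is given by its set of hyperedges. *)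
Definition minor_hypergraph (F : realType) (v : nat) (A : 'M[F]_v) (k : nat)
    (a : F) : {set {set 'I_v}} :=
  [set alpha : {set 'I_v} |
     (#|alpha| == k) && (\det (principal_submx A alpha) == a)].

Definition adjacency_mx (F : realType) (v : nat) (S : {set 'I_v * 'I_v}) :
    'M[F]_v :=
  \matrix_(x, y) ((x, y) \in S)%:R.

Record symmetric_scheme (F : realType) (v d : nat)
    (Rel : 'I_d.+1 -> {set 'I_v * 'I_v}) : Prop := SymmetricScheme {
  scheme_classes : (1 <= d)%N;
  scheme_nonempty : forall i, Rel i != set0;
  scheme_id : adjacency_mx F (Rel ord0) = 1%:M;
  scheme_sum : \sum_(i < d.+1) adjacency_mx F (Rel i) = const_mx 1;
  scheme_sym : forall i, (adjacency_mx F (Rel i))^T = adjacency_mx F (Rel i);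
  scheme_mul : forall i j, exists c : 'I_d.+1 -> F,
    adjacency_mx F (Rel i) *m adjacency_mx F (Rel j) =
      \sum_(l < d.+1) c l *: adjacency_mx F (Rel l)
}.

(* Membership in the F-algebra generated by the adjacency matrices; for a
   scheme, the unit 1%:M and 0 are obtained from bose_mesner_gen ord0 and
   bose_mesner_scale 0. *)
Inductive bose_mesner (F : realType) (v d : nat)
    (Rel : 'I_d.+1 -> {set 'I_v * 'I_v}) : 'M[F]_v -> Prop :=
| bose_mesner_gen i : bose_mesner Rel (adjacency_mx F (Rel i))
| bose_mesner_add A B :
    bose_mesner Rel A -> bose_mesner Rel B -> bose_mesner Rel (A + B)
| bose_mesner_scale (c : F) A : bose_mesner Rel A -> bose_mesner Rel (c *: A)
| bose_mesner_mul A B :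
    bose_mesner Rel A -> bose_mesner Rel B -> bose_mesner Rel (A *m B).

Definition uniform_hypergraph (v : nat) (B : {set {set 'I_v}}) : Prop :=
  exists k : nat, forall e, e \in B -> #|e| = k.

Definition one_design (v : nat) (B : {set {set 'I_v}}) : Prop :=
  exists2 r : nat, (0 < r)%N & forall x, #|[set e in B | x \in e]| = r.

Definition pbibd (v d : nat) (Rel : 'I_d.+1 -> {set 'I_v * 'I_v})
    (B : {set {set 'I_v}}) : Prop :=
  [/\ uniform_hypergraph B,
      one_design B
    & forall i : 'I_d.+1, i != ord0 -> exists lambda : nat,
        forall x y, (x, y) \in Rel i ->
          #|[set e in B | [set x; y] \subset e]| = lambda].

(* Main.v *)
(* For a vertex set S put W(S,k) = sum of det A[alpha] over the k-subsets alpha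
   containing S. The polynomial sum_k W(S,k) t^(v-k) is the determinant of
   A + t (1 - E_S), E_S being the projection onto the coordinates in S. With
   N = A + t invertible this determinant equals det N * det (1 - t N^-1[S]). As
   N^-1 lies in the Bose-Mesner algebra by Cayley-Hamilton, the value depends
   only on the relations between the points of S, for all but finitely many t;
   hence so does W(S,k). The case A = 1 gives the same for the number of
   k-subsets containing S. When the minors take only two values a and b, these
   two invariants determine how many alpha containing S have minor a. For S a
   point or a pair this is the claim. *)
Require Import Defs.
From mathcomp Require Import all_boot all_order all_algebra finmap.
From mathcomp Require Import perm reals.

Set Implicit Arguments.
Unset Strict Implicit.
Unset Printing Implicit Defensive.

Import GRing.Theory Num.Theory.
Local Open Scope ring_scope.

(** * Determinants: reindexing, block reduction, diagonal perturbation *)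

Lemma det_mxsub_bij (R : comPzRingType) (m n : nat) (h : 'I_m -> 'I_n)
    (B : 'M[R]_n) :
  bijective h -> \det (mxsub h h B) = \det B.
Proof.
move=> bij_h; have emn : m = n.
  by rewrite -[m]card_ord -[n]card_ord; apply: bij_eq_card bij_h.
subst m; pose s := perm (bij_inj bij_h).
have -> : mxsub h h B = row_perm s (col_perm s B).
  by apply/matrixP=> i j; rewrite !mxE !permE.
rewrite row_permE col_permE !det_mulmx !det_perm odd_permV mulrCA.
by rewrite -signr_addb addbb mulr1.
Qed.

(** Listing the image of [f] first makes [B] block upper triangular, since rows outside the image
    vanish off the diagonal; the lower right block is diagonal. *)
Lemma det_scalar_rows (R : comPzRingType) (m n : nat) (f : 'I_m -> 'I_n)
    (d : 'I_n -> R) (B : 'M[R]_n) :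
    injective f ->
    (forall i j, i \notin codom f -> B i j = d i *+ (i == j)) ->
  \det B = \det (mxsub f f B) * \prod_(i | i \notin codom f) d i.
Proof.
move=> inj_f rowB; pose C := [set i | i \notin codom f].
pose g : 'I_#|C| -> 'I_n := enum_val.
have gC j : g j \notin codom f by have := enum_valP j; rewrite inE.
pose h (i : 'I_(m + #|C|)) :=
  match split i with inl j => f j | inr j => g j end.
have hl j : h (lshift _ j) = f j by rewrite /h (unsplitK (inl j)).
have hr j : h (rshift _ j) = g j by rewrite /h (unsplitK (inr j)).
have bij_h : bijective h.
  apply: inj_card_bij => [i i'|].
    case: (split_ordP i) => j ->; case: (split_ordP i') => j' ->; rewrite ?hl ?hr.
    - by move/inj_f->.
    - by move=> fg; have := gC j'; rewrite -fg codom_f.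
    - by move=> fg; have := gC j; rewrite fg codom_f.
    - by move/enum_val_inj->.
  (* The image of [f] has [m] elements and [C] is its complement, so the cardinalities match. *)
  rewrite !card_ord -[leqLHS]card_ord -(cardC [in codom f]) (card_codom inj_f).
  by rewrite card_ord leq_add2l; apply/eq_leq/eq_card => i; rewrite !inE.
rewrite -(det_mxsub_bij B bij_h).
have -> : mxsub h h B =
    block_mx (mxsub f f B) (mxsub f g B) 0 (diag_mx (\row_j d (g j))).
  apply/matrixP=> i i'; rewrite mxE.
  case: (split_ordP i) => j ->; case: (split_ordP i') => j' ->; rewrite ?hl ?hr.
  - by rewrite block_mxEul mxE.
  - by rewrite block_mxEur mxE.
  - rewrite block_mxEdl mxE rowB //; case: eqP => // gf.
    by have := gC j; rewrite gf codom_f.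
  - by rewrite block_mxEdr !mxE rowB // (inj_eq enum_val_inj).
rewrite det_ublock det_diag; congr (_ * _).
under eq_bigr do rewrite mxE.
rewrite -(big_enum_val d) /=; by apply: eq_bigl => i; rewrite inE.
Qed.

(** Works over any commutative ring; over a [realType] it is convertible to the determinant of
    [principal_submx]. *)
Definition minor (R : comPzRingType) (n : nat) (A : 'M[R]_n)
    (alpha : {set 'I_n}) : R :=
  \det (mxsub (@enum_val _ (mem alpha)) (@enum_val _ (mem alpha)) A).

(** By multilinearity each row comes either from [A] or from the diagonal matrix; [alpha] records
    the rows taken from [A], and [det_scalar_rows] evaluates each term. *)
Lemma det_add_diag (R : comPzRingType) (n : nat) (d : 'I_n -> R)
    (A : 'M[R]_n) :
  \det (A + diag_mx (\row_i d i)) =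
    \sum_(alpha : {set 'I_n}) minor A alpha * \prod_(i | i \notin alpha) d i.
Proof.
pose B (alpha : {set 'I_n}) :=
  \matrix_(i, j) if i \in alpha then A i j else d i *+ (i == j).
transitivity (\sum_(alpha : {set 'I_n}) \det (B alpha)).
  (* In the Leibniz formula, [bigA_distr] expands a product of binary sums into a sum over
     subsets. *)
  rewrite exchange_big /=; apply: eq_bigr => s _; rewrite -mulr_sumr.
  under eq_bigr do rewrite !mxE.
  rewrite bigA_distr; congr (_ * _); apply: eq_bigr => alpha _.
  by apply: eq_bigr => i _; rewrite mxE.
apply: eq_bigr => alpha _.
have codomE i : (i \in codom (@enum_val _ (mem alpha))) = (i \in alpha).
  apply/codomP/idP => [[j ->]|ia]; first exact: enum_valP.
  by exists (enum_rank_in ia i); rewrite enum_rankK_in.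
rewrite (@det_scalar_rows _ _ _ _ d _ (@enum_val_inj _ (mem alpha))).
  congr (\det _ * _); last by apply: eq_bigl => i; rewrite codomE.
  by apply/matrixP=> i j; rewrite !mxE enum_valP.
by move=> i j; rewrite codomE mxE => /negPf->.
Qed.

Lemma poly_eq_on_nat (F : numDomainType) (p q : {poly F}) :
  (forall n : nat, p.[n%:R] = q.[n%:R]) -> p = q.
Proof.
move=> pq; apply/eqP; rewrite -subr_eq0; apply/negPn/negP => nz.
(* The first [size (p - q)] naturals are distinct in characteristic 0: one root too many. *)
have := @max_poly_roots _ _ [seq i%:R | i <- iota 0 (size (p - q))] nz.
rewrite size_map size_iota ltnn => /(_ _ _) H; suff: false by [].
apply: H.
  by apply/allP => x /mapP[i _ ->]; rewrite /root !hornerE pq subrr.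
by rewrite map_inj_uniq ?iota_uniq //; apply: mulrIn; rewrite oner_eq0.
Qed.

(** * The generating polynomial of sums of principal minors *)

Lemma minor_set0 (R : comPzRingType) (n : nat) (A : 'M[R]_n) :
  minor A set0 = 1.
Proof.
rewrite /minor; set f := enum_val; move: f; rewrite cards0 => f.
exact: det_mx00.
Qed.

Definition minor_sum (R : comPzRingType) (n : nat) (A : 'M[R]_n)
    (S : {set 'I_n}) (k : nat) : R :=
  \sum_(alpha : {set 'I_n} | (S \subset alpha) && (#|alpha| == k))
     minor A alpha.

(** The exponent counts the indices outside [alpha], each of which contributes a factor t from the
    diagonal. *)
Definition minor_poly (R : comNzRingType) (n : nat) (A : 'M[R]_n)
    (S : {set 'I_n}) : {poly R} :=
  \sum_(alpha : {set 'I_n} | S \subset alpha)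
     minor A alpha *: 'X^(n - #|alpha|).

Lemma horner_minor_poly (R : comNzRingType) (n : nat) (A : 'M[R]_n)
    (S : {set 'I_n}) (t : R) :
  (minor_poly A S).[t] = \det (A + diag_mx (\row_i (t *+ (i \notin S)))).
Proof.
rewrite det_add_diag horner_sum big_mkcond; apply: eq_bigr => alpha _.
have cardC_alpha : (n - #|alpha| = #|[pred i | i \notin alpha]|)%N.
  by have := cardC [in alpha]; rewrite card_ord => /(canRL (addKn _)) <-.
case: ifP => [/subsetP subS|/negbT].
  rewrite hornerZ hornerXn cardC_alpha -prodr_const; congr (_ * _).
  by apply: eq_bigr => i /(contra (subS i)) ->.
(* If [alpha] misses a point of [S], the zero diagonal entry there kills the term. *)
case/subsetPn=> i iS inA; rewrite (bigD1 i) //= iS mulr0n mul0r.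
by rewrite mulr0.
Qed.

Lemma coef_minor_poly (R : comNzRingType) (n : nat) (A : 'M[R]_n)
    (S : {set 'I_n}) (k : nat) :
  (k <= n)%N -> (minor_poly A S)`_(n - k) = minor_sum A S k.
Proof.
move=> le_kn; rewrite coef_sum /minor_sum [RHS]big_mkcondr /=.
apply: eq_bigr => alpha _; rewrite coefZ coefXn.
have le_an : (#|alpha| <= n)%N by have := max_card [in alpha]; rewrite card_ord.
(* Truncated subtraction is injective here because both cardinalities are at most [n]. *)
have -> : (n - k == n - #|alpha|)%N = (#|alpha| == k).
  apply/eqP/eqP => [e|-> //].
  by rewrite -(subKn le_an) -e subKn.
by case: eqP => _; rewrite ?mulr1 ?mulr0.
Qed.

(** The coefficient of degree [n] is the empty minor, 1. The value at t is det(A + t), so this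
    polynomial can be used as a cancellable factor. *)
Lemma minor_poly_set0_neq0 (R : comNzRingType) (n : nat) (A : 'M[R]_n) :
  minor_poly A set0 != 0.
Proof.
apply/negP => /eqP/(congr1 (fun p : {poly R} => p`_(n - 0))).
rewrite coef_minor_poly // coef0 /minor_sum (big_pred1 set0) => [|alpha].
  by rewrite minor_set0 => /eqP; rewrite oner_eq0.
by rewrite sub0set cards_eq0.
Qed.

(* [A + t (1 - E) = (1 - t E N^-1) N] with [N = A + t] and [E] the projection
   onto the coordinates in [f @: setT]. *)
Lemma minor_poly_factor (F : fieldType) (m n : nat) (A : 'M[F]_n)
    (f : 'I_m -> 'I_n) (t : F) :
    injective f -> A + t%:M \in unitmx ->
  (minor_poly A (f @: setT)).[t] =
    \det (1%:M - t *: mxsub f f (invmx (A + t%:M))) * \det (A + t%:M).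
Proof.
move=> inj_f unitN; set N := A + t%:M in unitN *.
set S := f @: setT.
have codomS i : (i \in codom f) = (i \in S).
  by apply/codomP/imsetP => [[j ->]|[j _ ->]]; exists j.
pose E : 'M[F]_n := diag_mx (\row_i (i \in S)%:R).
have -> : (minor_poly A S).[t] = \det ((1%:M - t *: (E *m invmx N)) *m N).
  rewrite horner_minor_poly mulmxBl mul1mx -scalemxAl mulmxKV //.
  congr (\det _); rewrite /N -addrA; congr (_ + _).
  apply/matrixP=> i j; rewrite !mxE; case: (i == j); last first.
    by rewrite !mulr0n mulr0 subr0.
  by rewrite !mulr1n; case: (i \in S); rewrite ?mulr1 ?mulr0 ?subrr ?subr0.
rewrite det_mulmx; congr (_ * _).
(* Outside [S], the rows of 1 - t E N^-1 are those of the identity. *)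
rewrite (@det_scalar_rows _ _ _ f (fun=> 1)) // => [|i j].
  rewrite prodr_const expr1n mulr1; congr (\det _).
  apply/matrixP=> i j.
  by rewrite mul_diag_mx !mxE (inj_eq inj_f) imset_f // mul1r.
rewrite codomS => /negPf iS; rewrite mxE mul_diag_mx !mxE iS.
by rewrite mul0r mulr0 subr0.
Qed.

(** * Entries and inverses in the Bose-Mesner algebra *)

Section Scheme.

Variables (F : realType) (v d : nat) (Rel : 'I_d.+1 -> {set 'I_v * 'I_v}).
Hypothesis hscheme : symmetric_scheme F Rel.

Let adj l := adjacency_mx F (Rel l).

Lemma bose_mesner_1 : bose_mesner Rel (1%:M : 'M[F]_v).
Proof. by rewrite -(scheme_id hscheme); apply: bose_mesner_gen. Qed.

(** By [scheme_mul] the span of the [adj l] is closed under products, so it is the whole algebra. *)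
Lemma bose_mesner_span (N : 'M[F]_v) :
  bose_mesner Rel N -> exists c, N = \sum_l c l *: adj l.
Proof.
have span_gen i : adj i = \sum_l (l == i)%:R *: adj l.
  rewrite (bigD1 i) //= eqxx scale1r big1 ?addr0 // => l /negPf->.
  by rewrite scale0r.
elim=> {N} [i|A B _ [a ->] _ [b ->]|c A _ [a ->]|A B _ [a ->] _ [b ->]].
- by exists (fun l => (l == i)%:R); apply: span_gen.
- exists (fun l => a l + b l); rewrite -big_split /=.
  by apply: eq_bigr => l _; rewrite scalerDl.
- exists (fun l => c * a l); rewrite scaler_sumr.
  by apply: eq_bigr => l _; rewrite scalerA.
have [e eE] : exists e, forall i j, adj i *m adj j = \sum_l e i j l *: adj l.
  have [e eE] := fin_all_exists (fun i => fin_all_exists (scheme_mul hscheme i)).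
  by exists e.
exists (fun l => \sum_i \sum_j a i * b j * e i j l).
under [RHS]eq_bigr do rewrite scaler_suml.
rewrite exchange_big mulmx_suml; apply: eq_bigr => i _.
under [RHS]eq_bigr do rewrite scaler_suml.
rewrite exchange_big mulmx_sumr; apply: eq_bigr => j _.
rewrite -scalemxAl -scalemxAr eE scalerA scaler_sumr.
by apply: eq_bigr => l _; rewrite scalerA.
Qed.

Lemma adj_class i x y l : (x, y) \in Rel i -> adj l x y = (l == i)%:R.
Proof.
move=> xyi; have := congr1 (fun M : 'M[F]_v => M x y) (scheme_sum hscheme).
(* Removing the term [i], which is 1, from the entry 1 of J leaves nonnegative terms with sum 0. *)
rewrite summxE [RHS]mxE (bigD1 i) //= mxE xyi => /(canRL (addKr _)).
rewrite addNr => /eqP; rewrite psumr_eq0 => [/allP H|j _]; last first.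
  by rewrite mxE ler0n.
have [->|ne] := eqVneq l i; first by rewrite mxE xyi.
by have := H l (mem_index_enum _); rewrite ne => /eqP.
Qed.

Lemma diag_class x : (x, x) \in Rel ord0.
Proof.
have := congr1 (fun M : 'M[F]_v => M x x) (scheme_id hscheme).
by rewrite !mxE eqxx; case: (_ \in _) => // /esym/eqP; rewrite oner_eq0.
Qed.

Lemma class_sym i x y : (x, y) \in Rel i -> (y, x) \in Rel i.
Proof.
move=> xyi; have := congr1 (fun M : 'M[F]_v => M y x) (scheme_sym hscheme i).
by rewrite !mxE xyi; case: (_ \in _) => // /eqP; rewrite oner_eq0.
Qed.

Lemma class_neq i x y : i != ord0 -> (x, y) \in Rel i -> x != y.
Proof.
move=> i0 xyi; apply: contraNneq i0 => exy; rewrite -exy in xyi.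
have := adj_class i xyi; rewrite (adj_class i (diag_class x)) eqxx.
by case: (i == ord0) => // /esym/eqP; rewrite oner_eq0.
Qed.

Lemma bose_mesner_class (N : 'M[F]_v) i x y x' y' :
    bose_mesner Rel N -> (x, y) \in Rel i -> (x', y') \in Rel i ->
  N x y = N x' y'.
Proof.
move=> /bose_mesner_span[c ->] xyi xyi'; rewrite !summxE.
by apply: eq_bigr => l _; rewrite mxE [RHS]mxE !(@adj_class i).
Qed.

(** Write the characteristic polynomial as q X + c, with c equal to det N up to sign;
    Cayley-Hamilton then gives N^-1 = - c^-1 q(N). *)
Lemma bose_mesner_invmx (N : 'M[F]_v) :
  bose_mesner Rel N -> bose_mesner Rel (invmx N).
Proof.
(* On a singular matrix [invmx] returns the matrix itself. *)
have [unitN|nunit] := boolP (N \in unitmx); last by rewrite /invmx (negPf nunit).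
have := bose_mesner_1; move: (Rel) N unitN => R'.
(* Polynomials are evaluated in a matrix ring of positive size, so size 0 is treated apart. *)
case: (v) R' => [R' N _ B1 BN|n R' N unitN B1 BN].
  by rewrite (_ : invmx N = N) //; apply/matrixP => - [].
have B_horner p : bose_mesner R' (horner_mx N p).
  elim/poly_ind: p => [|p c Bp].
    by rewrite rmorph0 -(scale0r 1%:M); apply: bose_mesner_scale.
  rewrite rmorphD rmorphM /= horner_mx_X horner_mx_C -scalemx1.
  by apply: bose_mesner_add; [apply: bose_mesner_mul|apply: bose_mesner_scale].
have [q [c pE]] : exists q c, char_poly N = q * 'X + c%:P.
  elim/poly_ind: (char_poly N) => [|q c _]; last by exists q, c.
  by exists 0, 0; rewrite mul0r addr0.
have c_neq0 : c != 0.
  have := char_poly_det N; rewrite pE coefD coefMX coefC /= add0r => ->.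
  by rewrite mulf_neq0 ?signr_eq0 // -unitfE -unitmxE.
have := Cayley_Hamilton N; rewrite pE rmorphD rmorphM /= horner_mx_X horner_mx_C.
move=> /(canRL (addrK _)); rewrite sub0r => /(congr1 (fun M => M *m invmx N)).
rewrite mulmxK // mulNmx mul_scalar_mx => qE.
have -> : invmx N = (- c^-1) *: horner_mx N q.
  by rewrite qE scalerN scaleNr opprK scalerA mulVf // scale1r.
exact: bose_mesner_scale.
Qed.

(** * Invariance of minor sums and of hyperedge counts *)

Lemma minor_sum_invariant (m k : nat) (f g : 'I_m -> 'I_v) (A : 'M[F]_v) :
    bose_mesner Rel A -> injective f -> injective g ->
    (forall i j, exists2 l, (f i, f j) \in Rel l & (g i, g j) \in Rel l) ->
  minor_sum A (f @: setT) k = minor_sum A (g @: setT) k.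
Proof.
move=> BA inj_f inj_g fg; have [le_kv|lt_vk] := leqP k v; last first.
  rewrite /minor_sum !big1 // => alpha /andP[_ /eqP ka];
  by have := max_card [in alpha]; rewrite card_ord ka leqNgt lt_vk.
rewrite -!coef_minor_poly //.
suff -> : minor_poly A (f @: setT) = minor_poly A (g @: setT) by [].
(* After multiplication by det(A + t), both sides vanish where A + t is singular, so the
   factorization is needed only where it is invertible. *)
apply: (mulIf (minor_poly_set0_neq0 A)); apply: poly_eq_on_nat => n.
rewrite !hornerM [(minor_poly A set0).[_]]horner_minor_poly.
have -> : diag_mx (\row_i (n%:R *+ (i \notin set0))) = n%:R%:M :> 'M[F]_v.
  by apply/matrixP=> i j; rewrite !mxE inE.
have [->|nz] := eqVneq (\det (A + n%:R%:M)) 0; first by rewrite !mulr0.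
have unitN : A + n%:R%:M \in unitmx by rewrite unitmxE unitfE.
rewrite !minor_poly_factor //; congr (\det (_ - _ *: _) * _ * _).
apply/matrixP=> i j; rewrite !mxE.
have [l fl gl] := fg i j; apply: bose_mesner_class fl gl.
apply/bose_mesner_invmx/bose_mesner_add => //.
by rewrite -scalemx1; apply/bose_mesner_scale/bose_mesner_1.
Qed.

Lemma minor_hypergraph_invariant (m k : nat) (f g : 'I_m -> 'I_v)
    (A : 'M[F]_v) (a : F) :
    bose_mesner Rel A -> injective f -> injective g ->
    (forall i j, exists2 l, (f i, f j) \in Rel l & (g i, g j) \in Rel l) ->
    #|` minor_values A k|%fset = 2%N -> a \in minor_values A k ->
  #|[set e in minor_hypergraph A k a | f @: setT \subset e]| =
  #|[set e in minor_hypergraph A k a | g @: setT \subset e]|.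
Proof.
move=> BA inj_f inj_g fg hD aD.
have [b bE] : exists b, (minor_values A k `\ a = [fset b])%fset.
  by apply/cardfs1P; move/eqP: hD; rewrite (cardfsD1 a) aD.
have ab : b != a.
  by have : b \in (minor_values A k `\ a)%fset by [rewrite bE inE]; case/fsetD1P.
(* The minor is affine in the indicator of being a hyperedge; the constant 1 is written as a minor
   of the identity so that its sum is again a [minor_sum]. *)
have minorE (e : {set 'I_v}) : #|e| = k ->
    minor A e = b * minor 1%:M e + (a - b) * (e \in minor_hypergraph A k a)%:R.
  move=> ek; have -> : minor 1%:M e = 1 :> F.
    rewrite /minor -[RHS](det1 _ #|e|); congr (\det _); apply/matrixP=> i j.
    by rewrite !mxE (inj_eq enum_val_inj).
  have eD : minor A e \in minor_values A k.
    by apply/imfsetP; exists e; rewrite ?inE ?ek.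
  have -> : (e \in minor_hypergraph A k a) = (minor A e == a).
    by rewrite inE (introT eqP ek).
  have [->|ne] := eqVneq (minor A e) a; first by rewrite !mulr1 addrC subrK.
  rewrite mulr0 addr0 mulr1; apply/fset1P.
  by rewrite -bE; apply/fsetD1P.
have sumE S : minor_sum A S k = b * minor_sum 1%:M S k +
    (a - b) * #|[set e in minor_hypergraph A k a | S \subset e]|%:R.
  rewrite /minor_sum -sum1_card natr_sum !mulr_sumr.
  rewrite [X in _ = _ + X](eq_bigl (fun e : {set 'I_v} =>
    ((S \subset e) && (#|e| == k)) && (e \in minor_hypergraph A k a))); last first.
    by move=> e; rewrite !inE; case: (_ == k); rewrite ?andbF //= andbT andbC.
  rewrite [X in _ + X]big_mkcondr -big_split /=; apply: eq_bigr => e.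
  by case/andP=> _ /eqP/minorE->; case: (e \in _); rewrite ?mulr0.
have := minor_sum_invariant k BA inj_f inj_g fg.
rewrite !sumE (minor_sum_invariant k bose_mesner_1 inj_f inj_g fg).
(* The factor a - b is nonzero, so the counts agree in [F], hence as naturals. *)
move/addrI/mulfI => /(_ _)/eqP; rewrite subr_eq0 eq_sym ab => /(_ isT).
by rewrite eqr_nat => /eqP.
Qed.

End Scheme.

(** * Vertex degrees and pair counts *)

Theorem corollary3p3 (F : realType) (v d : nat)
    (Rel : 'I_d.+1 -> {set 'I_v * 'I_v}) (A : 'M[F]_v) (k : nat)
    (hscheme : symmetric_scheme F Rel) (hA : bose_mesner Rel A)
    (hk : (0 < k)%N) (hD : #|` minor_values A k|%fset = 2%N) :
  forall a : F, a \in minor_values A k -> pbibd Rel (minor_hypergraph A k a).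
Proof.
move=> a aD; split.
- by exists k => e; rewrite inE => /andP[/eqP].
- have degE x : #|[set e in minor_hypergraph A k a | x \in e]| =
      #|[set e in minor_hypergraph A k a |
           (fun=> x) @: [set: 'I_1] \subset e]|.
    suff -> : (fun=> x) @: [set: 'I_1] = [set x].
      by apply: eq_card => e; rewrite !inE sub1set.
    apply/setP=> y; rewrite inE.
    by apply/imsetP/eqP => [[i _ ->] //|->]; exists ord0.
  (* A set realizing the value [a] is nonempty since k > 0; any of its points has positive
     degree. *)
  have [e0] := imfsetP _ _ _ _ aD; rewrite inE /= => /eqP e0k aE.
  have /card_gt0P[x0 x0e] : (0 < #|e0|)%N by rewrite e0k.
  exists #|[set e in minor_hypergraph A k a | x0 \in e]|.
    by apply/card_gt0P; exists e0; rewrite !inE (introT eqP e0k) aE eqxx.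
  move=> x; rewrite !degE; apply: (minor_hypergraph_invariant hscheme) => //.
  + by move=> i j _; rewrite !ord1.
  + by move=> i j _; rewrite !ord1.
  + by move=> _ _; exists ord0; exact: (diag_class hscheme).
- move=> i i0; pose p x y (j : 'I_2) : 'I_v := if j == ord0 then x else y.
  have pairE x y : #|[set e in minor_hypergraph A k a | [set x; y] \subset e]| =
      #|[set e in minor_hypergraph A k a | p x y @: setT \subset e]|.
    suff -> : [set x; y] = p x y @: setT by [].
    apply/setP=> z; rewrite !inE; apply/orP/imsetP => [[]/eqP->|[j _ ->]].
    - by exists ord0.
    - by exists ord_max.
    - by rewrite /p; case: ifP => _; rewrite eqxx; [left|right].
  have inj_p x y : (x, y) \in Rel i -> injective (p x y).
    move=> /(class_neq hscheme i0)/eqP xy [[|[|j]] hj] [[|[|j']] hj'] // e;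
      by [apply: val_inj | case: xy; rewrite /p /= in e *].
  (* A reference pair in the nonempty relation supplies lambda. *)
  have /set0Pn[[x0 y0] xy0] := scheme_nonempty hscheme i.
  exists #|[set e in minor_hypergraph A k a | [set x0; y0] \subset e]|.
  move=> x y xy; rewrite !pairE.
  apply: (minor_hypergraph_invariant hscheme) => //; [exact: inj_p|exact: inj_p|].
  (* Equal positions give the diagonal relation, distinct ones [Rel i], by symmetry in the reversed
     order. *)
  move=> j j'; rewrite /p; case: (j == ord0); case: (j' == ord0).
  + by exists ord0; exact: (diag_class hscheme).
  + by exists i.
  + by exists i; exact: (class_sym hscheme).
  + by exists ord0; exact: (diag_class hscheme).
Qed.
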